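(* Let $p>2$, let $T$ be a tree, let $\lambda: T\to(0,\infty)$ be a weight, and let $\varphi:T\to T$ be an injective self-map such that $C_\varphi$ is compact on $L^2_\lambda(T)$. If $C_\varphi\in S_p$, then $$\sum_{u\in T}\Big[\frac{\lambda(\varphi^{-1}(u))}{\lambda(u)}\Big]^{p/2}<\infty.$$
   Context: A tree $T$ is a connected, locally finite graph without cycles on a countably infinite vertex set (identified with $T$), with a fixed vertex $o$ called the root, and with no terminal vertices (a terminal vertex is one having only one neighbour). For a weight $\lambda:T\to(0,\infty)$, $L^2_\lambda(T)$ is the separable Hilbert space of functions $f:T\to\mathbb{C}$ with $\sum_{v\in T}|f(v)|^2\lambda(v)<\infty$, with inner product $\langle f,g\rangle=\sum_{v\in T}f(v)\overline{g(v)}\lambda(v)$. The composition operator is $C_\varphi f(v)=f(\varphi(v))$. For injective $\varphi$ and $u\in T$, $\lambda(\varphi^{-1}(u))$ denotes $\lambda(w)$ if $w$ is the unique vertex with $\varphi(w)=u$, and $0$ if $u\notin\varphi(T)$. $S_p$ is the Schatten $p$-class of $L^2_\lambda(T)$: the compact operators $A$ whose singular values $\{\mu_n\}$ satisfy $\sum_n|\mu_n|^p<\infty$. *)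

(* Defs.v *)
From HB Require Import structures.
From mathcomp Require Import all_boot all_order all_algebra.
From mathcomp Require Import sesquilinear complex.
From mathcomp Require Import all_classical all_reals all_analysis.
From mathcomp Require Import ring lra.

Set Implicit Arguments.
Unset Strict Implicit.
Unset Printing Implicit Defensive.

Import Order.TTheory GRing.Theory Num.Theory numFieldNormedType.Exports.
Import Normc.

Local Open Scope classical_set_scope.
Local Open Scope card_scope.
Local Open Scope complex_scope.
Local Open Scope ring_scope.

Record tree := Tree {
  vertex :> countType;
  root : vertex;
  adj : rel vertex;
  adj_sym : symmetric adj;
  adj_irr : irreflexive adj;
  tree_infinite : infinite_set [set: vertex];
  tree_connected : forall x y, exists s, path adj x s /\ last x s = y;
  (* [x; y] is a closed walk along the single edge xy, not a graph cycle *)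
  tree_acyclic : forall s, ucycle adj s -> (size s <= 2)%N;
  tree_locally_finite : forall x, finite_set [set y | adj x y];
  tree_no_terminal : forall x, ~ exists y, [set z | adj x z] = [set y]
}.

Section sums.
Variables (R : realType) (T : choiceType).
Implicit Types (a b : T -> R) (F G : T -> R[i]).

Definition rsummable a := summable [set: T] (EFin \o a).

(* Meaningful only for [rsummable a] (positive part minus negative part). *)
Definition rsum a : R :=
  fine (\esum_(x in [set: T]) (EFin \o a)^\+%E x)
  - fine (\esum_(x in [set: T]) (EFin \o a)^\-%E x).

Definition csummable F := rsummable (fun x => complex.Re (F x)) /\
  rsummable (fun x => complex.Im (F x)).

Definition csum F : R[i] :=
  (rsum (fun x => complex.Re (F x))) +i* (rsum (fun x => complex.Im (F x))).

Lemma rsummable_fin a : rsummable a -> (forall x, 0 <= a x) ->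
  \esum_(x in [set: T]) (a x)%:E \is a fin_num.
Proof.
move=> sa a0; rewrite ge0_fin_numE; last by apply: esum_ge0 => x _; rewrite lee_fin.
apply: le_lt_trans sa; apply: le_esum => x _ /=.
by rewrite lee_fin ler_norm.
Qed.

Lemma rsummable_le a b : (forall x, `|a x| <= b x) -> rsummable b -> rsummable a.
Proof.
move=> ab; apply: le_lt_trans; apply: le_esum => x _ /=.
by rewrite lee_fin (le_trans (ab x)) // ler_norm.
Qed.

Lemma rsummableD a b : rsummable a -> rsummable b ->
  rsummable (fun x => a x + b x).
Proof. by move=> sa sb; have := summableD sa sb. Qed.

Lemma rsummableN a : rsummable a -> rsummable (fun x => - a x).
Proof. by rewrite /rsummable summableN. Qed.

Lemma esumZ_le (c : R) (a : T -> \bar R) : 0 < c -> (forall x, 0 <= a x)%E ->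
  (\esum_(x in [set: T]) (c%:E * a x) <= c%:E * \esum_(x in [set: T]) a x)%E.
Proof.
move=> c0 a0; apply: ge_ereal_sup => _ [A [finA _] <-].
rewrite -ge0_mule_fsumr //; apply: lee_pmul => //; first by rewrite lee_fin ltW.
  by apply: fsume_ge0.
by apply: ereal_sup_ubound; exists A.
Qed.

Lemma esumZ (c : R) (a : T -> \bar R) : 0 < c -> (forall x, 0 <= a x)%E ->
  (\esum_(x in [set: T]) (c%:E * a x) = c%:E * \esum_(x in [set: T]) a x)%E.
Proof.
move=> c0 a0; apply/eqP; rewrite eq_le esumZ_le //=.
have ca0 x : (0 <= c%:E * a x)%E by rewrite mule_ge0 // lee_fin ltW.
have ci : 0 < c^-1 by rewrite invr_gt0.
have := esumZ_le ci ca0.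
under eq_esum => x _ do rewrite muleA -EFinM mulVf ?gt_eqF // mul1e.
by rewrite -lee_pdivlMl.
Qed.

Lemma rsummableZ c a : rsummable a -> rsummable (fun x => c * a x).
Proof.
move=> sa; have [->|c0] := eqVneq c 0.
  by rewrite /rsummable /summable esum1 // => x _ /=; rewrite mul0r normr0.
rewrite /rsummable /summable.
under eq_esum => x _ do rewrite /= normrM EFinM.
rewrite esumZ ?normr_gt0 // lte_mul_pinfty // lee_fin normr_ge0.
Qed.

Lemma rsumB a b : rsummable a -> rsummable b ->
  (forall x, 0 <= a x) -> (forall x, 0 <= b x) ->
  rsum (fun x => a x - b x) = fine (\esum_(x in [set: T]) (a x)%:E)
    - fine (\esum_(x in [set: T]) (b x)%:E).
Proof.
move=> sa sb a0 b0; have sab : rsummable (fun x => a x - b x).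
  by apply: rsummableD => //; apply: rsummableN.
have e0 (c : T -> R) : (forall x, 0 <= c x) ->
    forall x, [set: T] x -> (0 <= (EFin \o c) x)%E.
  by move=> c0 x _; rewrite lee_fin.
have E := esumB sa sb (e0 a a0) (e0 b b0).
rewrite /rsum -fineB ?E ?fineB ?rsummable_fin //.
- have := summable_funepos sab; rewrite summableE.
  by under eq_esum => x _ do rewrite gee0_abs //.
- have := summable_funeneg sab; rewrite summableE.
  by under eq_esum => x _ do rewrite gee0_abs //.
Qed.

Lemma rsum_ge0E a : rsummable a -> (forall x, 0 <= a x) ->
  rsum a = fine (\esum_(x in [set: T]) (a x)%:E).
Proof.
move=> sa a0; have s0 : rsummable (fun=> 0 : R).
  by apply: rsummable_le sa => x; rewrite normr0.
have := rsumB sa s0 a0 (fun=> lexx _); rewrite [X in _ - fine X]esum1 // subr0 => <-.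
by congr rsum; apply/funext => x; rewrite subr0.
Qed.

Lemma rsum_ge0 a : rsummable a -> (forall x, 0 <= a x) -> 0 <= rsum a.
Proof.
by move=> sa a0; rewrite rsum_ge0E // fine_ge0 // esum_ge0 // => x _; rewrite lee_fin.
Qed.

Let pos a x := Num.max (a x) 0.
Let neg a x := Num.max (- a x) 0.

Let pos_ge0 a x : 0 <= pos a x. Proof. by rewrite le_max lexx orbT. Qed.
Let neg_ge0 a x : 0 <= neg a x. Proof. by rewrite le_max lexx orbT. Qed.

Let posneg a x : a x = pos a x - neg a x.
Proof. by rewrite /pos /neg; case: (leP (a x) 0); case: (leP (- a x) 0); lra. Qed.

Let summable_abs a : rsummable a -> rsummable (fun x => `|a x|).
Proof. by apply: le_lt_trans; apply: le_esum => x _ /=; rewrite normr_id. Qed.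

Let pos_summable a : rsummable a -> rsummable (pos a).
Proof.
move=> /summable_abs; apply: rsummable_le => x.
by rewrite ger0_norm // ge_max ler_norm normr_ge0.
Qed.

Let neg_summable a : rsummable a -> rsummable (neg a).
Proof.
move=> /summable_abs; apply: rsummable_le => x.
by rewrite ger0_norm // ge_max -normrN ler_norm normr_ge0.
Qed.

Let rsum_posneg a : rsummable a ->
  rsum a = fine (\esum_(x in [set: T]) (pos a x)%:E)
    - fine (\esum_(x in [set: T]) (neg a x)%:E).
Proof.
move=> sa; rewrite -rsumB //; [|exact: pos_summable|exact: neg_summable].
by congr rsum; apply/funext => x; exact: posneg.
Qed.

Lemma rsumD a b : rsummable a -> rsummable b ->
  rsum (fun x => a x + b x) = rsum a + rsum b.
Proof.
move=> sa sb; have [pa na] := (pos_summable sa, neg_summable sa).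
have [pb nb] := (pos_summable sb, neg_summable sb).
have fD (p q : T -> R) : rsummable p -> rsummable q -> (forall x, 0 <= p x) ->
    (forall x, 0 <= q x) -> fine (\esum_(x in [set: T]) (p x + q x)%:E)
    = fine (\esum_(x in [set: T]) (p x)%:E) + fine (\esum_(x in [set: T]) (q x)%:E).
  move=> sp sq p0 q0; rewrite -fineD ?rsummable_fin // -esumD //.
  by move=> x _; rewrite lee_fin.
  by move=> x _; rewrite lee_fin.
have -> : (fun x => a x + b x) =
    (fun x => (pos a x + pos b x) - (neg a x + neg b x)).
  by apply/funext => x; rewrite {1}(posneg a) {1}(posneg b); ring.
rewrite rsumB; first last.
- by move=> x; rewrite addr_ge0.
- by move=> x; rewrite addr_ge0.
- exact: rsummableD.
- exact: rsummableD.
rewrite (fD _ _ pa pb (pos_ge0 a) (pos_ge0 b)).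
rewrite (fD _ _ na nb (neg_ge0 a) (neg_ge0 b)).
by rewrite (rsum_posneg sa) (rsum_posneg sb) opprD addrACA.
Qed.

Lemma rsum0 : rsum (fun=> 0 : R) = 0.
Proof.
rewrite rsum_ge0E ?esum1 //.
by rewrite /rsummable /summable esum1 // => x _ /=; rewrite normr0.
Qed.

Lemma rsumN a : rsummable a -> rsum (fun x => - a x) = - rsum a.
Proof.
move=> sa; apply/eqP; rewrite -addr_eq0 -rsumD //; last exact: rsummableN.
by apply/eqP; rewrite -[RHS]rsum0; congr rsum; apply/funext => x; rewrite addNr.
Qed.

Lemma rsumZ c a : rsummable a -> rsum (fun x => c * a x) = c * rsum a.
Proof.
move=> sa; wlog c0 : c / 0 < c.
  move=> H; have [c0|c0|->] := ltrgtP c 0; last 1 first.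
  - by rewrite mul0r -[RHS]rsum0; congr rsum; apply/funext => x; rewrite mul0r.
  - have := H (- c); rewrite oppr_gt0 mulNr => /(_ c0) E.
    apply: oppr_inj; rewrite -E -rsumN; last exact: rsummableZ.
    by congr rsum; apply/funext => x; rewrite mulNr.
  - exact: H.
have [pa na] := (pos_summable sa, neg_summable sa).
rewrite (_ : (fun x => c * a x) = (fun x => c * pos a x - c * neg a x)); last first.
  by apply/funext => x; rewrite {1}(posneg a) mulrBr.
rewrite rsumB; try exact: rsummableZ; try by move=> x; rewrite mulr_ge0 // ltW.
rewrite (rsum_posneg sa) mulrBr.
have fZ (p : T -> R) : rsummable p -> (forall x, 0 <= p x) ->
    fine (\esum_(x in [set: T]) (c * p x)%:E)
    = c * fine (\esum_(x in [set: T]) (p x)%:E).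
  move=> sp p0; under eq_esum => x _ do rewrite EFinM.
  by rewrite esumZ // fineM ?rsummable_fin.
by rewrite (fZ _ pa (pos_ge0 a)) (fZ _ na (neg_ge0 a)).
Qed.

Lemma le_rsum1 a x : rsummable a -> (forall x, 0 <= a x) -> a x <= rsum a.
Proof.
move=> sa a0; rewrite rsum_ge0E // -lee_fin fineK ?rsummable_fin //.
have := @esum_ge _ _ [set: T] (EFin \o a) (a x)%:E; apply.
by exists [set x] => //; rewrite fsbig_set1.
Qed.

Lemma csummableD F G : csummable F -> csummable G ->
  csummable (fun x => F x + G x).
Proof.
move=> [F1 F2] [G1 G2]; split.
- by have := rsummableD F1 G1; congr rsummable; apply/funext => x; rewrite raddfD.
- by have := rsummableD F2 G2; congr rsummable; apply/funext => x; rewrite raddfD.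
Qed.

Lemma csumD F G : csummable F -> csummable G ->
  csum (fun x => F x + G x) = csum F + csum G.
Proof.
move=> [F1 F2] [G1 G2]; rewrite /csum; simpc; congr Complex.
- by rewrite -rsumD //; congr rsum; apply/funext => x; rewrite raddfD.
- by rewrite -rsumD //; congr rsum; apply/funext => x; rewrite raddfD.
Qed.

Lemma csumZ c F : csummable F -> csum (fun x => c * F x) = c * csum F.
Proof.
case: c => c d [F1 F2]; rewrite /csum; simpc; congr Complex.
- rewrite -(rsumZ c F1) -(rsumZ d F2) -(rsumN (rsummableZ d F2)).
  rewrite -(rsumD (rsummableZ c F1) (rsummableN (rsummableZ d F2))).
  by congr rsum; apply/funext => x; case: (F x).
- rewrite -(rsumZ c F2) -(rsumZ d F1).
  rewrite -(rsumD (rsummableZ c F2) (rsummableZ d F1)).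
  by congr rsum; apply/funext => x; case: (F x).
Qed.

Lemma csum_conj F : csummable F -> csum (fun x => (F x)^*) = (csum F)^*.
Proof.
move=> [F1 F2]; rewrite /csum; congr Complex.
- by congr rsum; apply/funext => x; case: (F x).
- by rewrite -rsumN //; congr rsum; apply/funext => x; case: (F x).
Qed.

End sums.

Section dot_norm.
Variables (R : realType) (H : lmodType R[i]) (dot : {dot H for Num.conj}).
Implicit Types u v : H.

Definition dot_norm u : R[i] := sqrtC (dot u u).

Lemma dot_ge0 u : 0 <= dot u u.
Proof.
have [->|u0] := eqVneq u 0; first by rewrite linear0l.
by rewrite ltW // neq0_dnorm_gt0.
Qed.

Lemma dot_norm_eq0 u : dot_norm u = 0 -> u = 0.
Proof.
move/eqP; rewrite sqrtC_eq0 => /eqP d0; apply/eqP; apply: contraT => u0.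
by have := neq0_dnorm_gt0 (s := dot) u u0; rewrite d0 ltxx.
Qed.

Lemma dot_normZ (l : R[i]) u : dot_norm (l *: u) = `|l| * dot_norm u.
Proof.
rewrite /dot_norm linearZl_LR linearZr_LR /= mulrA -normCK.
by rewrite sqrtCM ?sqrCK ?nnegrE ?exprn_ge0 ?dot_ge0.
Qed.

Lemma dot_normD u v : dot_norm (u + v) <= dot_norm u + dot_norm v.
Proof.
have [n0u n0v] : 0 <= dot_norm u /\ 0 <= dot_norm v by rewrite !sqrtC_ge0 !dot_ge0.
have [u0|u0] := eqVneq (dot_norm u) 0.
  by rewrite (dot_norm_eq0 u0) add0r lerDr -(dot_norm_eq0 u0).
have [v0|v0] := eqVneq (dot_norm v) 0.
  by rewrite (dot_norm_eq0 v0) addr0 lerDl -(dot_norm_eq0 v0).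
rewrite -ler_sqr ?nnegrE ?addr_ge0 ?sqrtC_ge0 ?dot_ge0 // sqrtCK.
set a := dot_norm u in n0u u0 *; set b := dot_norm v in n0v v0 *.
have ea : dot u u = a ^+ 2 by rewrite sqrtCK.
have eb : dot v v = b ^+ 2 by rewrite sqrtCK.
have ab : 0 < a * b by rewrite mulr_gt0 // lt_def ?u0 ?v0.
have ra : a^* = a by apply/CrealP; rewrite ger0_real.
have rb : b^* = b by apply/CrealP; rewrite ger0_real.
have := dot_ge0 (b *: u - a *: v).
rewrite hnormB hnormD !linearZl_LR !linearZr_LR /= !rmorphM /= ra rb ea eb expr0 mul1r.
set d := dot u v; rewrite ra mul1r => h.
have {}h : 0 <= (a * b) * (a * b *+ 2 - (d + d^*)).
  move: h; congr (_ <= _).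
  change (b * (b * a ^+ 2) + a * (a * b ^+ 2) - (a * (b * d) + a * (b * d^*))
    = a * b * (a * b *+ 2 - (d + d^*))).
  by ring.
rewrite pmulr_rge0 // subr_ge0 in h.
by rewrite sqrrD addrAC lerD2r lerD2l.
Qed.

End dot_norm.

Section L2.
Variables (R : realType) (T : choiceType) (lam : T -> {posnum R}).

Definition L2pred : {pred T -> R[i]} := fun f =>
  (\esum_(v in [set: T]) (normc (f v) ^+ 2 * (lam v)%:num)%:E < +oo)%E.

Lemma normc_ge0 (z : R[i]) : 0 <= normc z.
Proof. by case: z => x y; exact: sqrtr_ge0. Qed.

Lemma L2predE (f : T -> R[i]) :
  (f \in L2pred) = rsummable (fun v => normc (f v) ^+ 2 * (lam v)%:num).
Proof.
rewrite unfold_in /rsummable /summable; congr (_ < _)%E.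
by apply: eq_esum => v _ /=; rewrite ger0_norm // mulr_ge0 // sqr_ge0.
Qed.

Lemma L2_submod : subsemimod_closed L2pred.
Proof.
split; first split.
- rewrite L2predE /rsummable /summable esum1 // => v _ /=.
  change ((`|normc (0 : R[i]) ^+ 2 * (lam v)%:num|)%:E = 0%E).
  by rewrite normc0 expr0n mul0r normr0.
- move=> f g; rewrite !L2predE => sf sg.
  apply: rsummable_le (rsummableD (rsummableZ 2 sf) (rsummableZ 2 sg)) => v.
  rewrite ger0_norm; last by rewrite mulr_ge0 // sqr_ge0.
  rewrite !mulrA -mulrDl ler_wpM2r //.
  have := le_normcD (f v) (g v); have := normc_ge0 (f v); have := normc_ge0 (g v).
  have := normc_ge0 (f v + g v).
  set x := normc _; set y := normc _; set z := normc _ => x0 y0 z0 xyz.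
  rewrite (@le_trans _ _ ((z + y) ^+ 2)) //; first by rewrite ler_sqr ?nnegrE ?addr_ge0.
  by have := sqr_ge0 (z - y); nra.
- move=> c f; rewrite !L2predE => sf.
  apply: rsummable_le (rsummableZ (normc c ^+ 2) sf) => v.
  rewrite ger0_norm; last by rewrite mulr_ge0 // sqr_ge0.
  by rewrite mulrA -exprMn -normcM.
Qed.

HB.instance Definition _ :=
  GRing.isSubmodClosed.Build R[i] (T -> R[i]) L2pred L2_submod.

Record L2 := MkL2 { L2fun :> T -> R[i]; L2P : L2fun \in L2pred }.

HB.instance Definition _ := [isSub for L2fun].
HB.instance Definition _ := [Choice of L2 by <:].
HB.instance Definition _ := [SubChoice_isSubLmodule of L2 by <:].

Definition L2dot (f g : L2) : R[i] :=
  csum (fun v => f v * (g v)^* * ((lam v)%:num)%:C).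

Lemma L2dot_summable (f g : L2) :
  csummable (fun v => f v * (g v)^* * ((lam v)%:num)%:C).
Proof.
have [] := (L2P f, L2P g); rewrite !L2predE => sf sg.
have bnd v : [/\ `|complex.Re (f v * (g v)^* * ((lam v)%:num)%:C)| <=
      normc (f v) ^+ 2 * (lam v)%:num + normc (g v) ^+ 2 * (lam v)%:num
    & `|complex.Im (f v * (g v)^* * ((lam v)%:num)%:C)| <=
      normc (f v) ^+ 2 * (lam v)%:num + normc (g v) ^+ 2 * (lam v)%:num].
  have l0 : 0 <= (lam v)%:num by [].
  move: ((lam v)%:num : R) l0 => l l0; case: (f v) => a b; case: (g v) => c d.
  rewrite /normc !sqr_sqrtr ?addr_ge0 ?sqr_ge0 //.
  have -> : (a +i* b) * (c +i* d)^* * l%:C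
      = ((a * c + b * d) * l) +i* ((b * c - a * d) * l).
    by simpc; congr Complex; ring.
  rewrite /= !normrM (ger0_norm l0).
  have -> : (a ^+ 2 + b ^+ 2) * l + (c ^+ 2 + d ^+ 2) * l
      = (a ^+ 2 + b ^+ 2 + c ^+ 2 + d ^+ 2) * l by ring.
  have := sqr_ge0 (a + c); have := sqr_ge0 (b + d); have := sqr_ge0 (a - c).
  have := sqr_ge0 (b - d); have := sqr_ge0 (a + d); have := sqr_ge0 (b - c).
  have := sqr_ge0 (a - d); have := sqr_ge0 (b + c); have := sqr_ge0 a.
  have := sqr_ge0 b; have := sqr_ge0 c; have := sqr_ge0 d => *.
  by split; apply: ler_wpM2r => //; rewrite ler_norml; apply/andP; split; nra.
have sfg := rsummableD sf sg.
by split; apply: rsummable_le sfg => v; have [] := bnd v.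
Qed.

Lemma L2dotC f g : L2dot f g = (L2dot g f)^*.
Proof.
have := csum_conj (L2dot_summable g f); rewrite /L2dot => <-.
congr csum; apply/funext => v.
by case: (f v) => a b; case: (g v) => c d; simpc; congr Complex; ring.
Qed.

Lemma L2dot_linearl (h : L2) : linear_for *%R (L2dot ^~ h).
Proof.
move=> c f g; have [sf sg] := (L2dot_summable f h, L2dot_summable g h).
have scf : csummable (fun v => c * (f v * (h v)^* * ((lam v)%:num)%:C)).
  have := L2dot_summable (c *: f) h; congr csummable; apply/funext => v.
  by rewrite !mulrA.
rewrite /L2dot -csumZ // -csumD //; congr csum; apply/funext => v.
rewrite -[(c *: f + g) v]/(c * f v + g v).
by rewrite !mulrDl !mulrA.
Qed.

Lemma L2dot_linearr (f : L2) : linear_for (Num.conj \; *%R) (L2dot f).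
Proof.
move=> c g h; rewrite L2dotC L2dot_linearl rmorphD rmorphM /=.
by rewrite -!L2dotC.
Qed.

HB.instance Definition _ := bilinear_isBilinear.Build R[i] L2 L2 R[i]
  *%R (Num.conj \; *%R) L2dot (L2dot_linearl, L2dot_linearr).

Lemma L2dot_hermitian f g : L2dot f g = (-1) ^+ false * (L2dot g f)^*.
Proof. by rewrite expr0 mul1r -L2dotC. Qed.

HB.instance Definition _ :=
  isHermitianSesquilinear.Build R[i] L2 false Num.conj L2dot L2dot_hermitian.

Lemma L2dot_gt0 (f : L2) : f != 0 -> 0 < L2dot f f.
Proof.
move=> f0; have [v fv0] : exists v, f v != 0.
  apply: contra_notP (negP f0) => nf; apply/eqP/val_inj/funext => v /=.
  by apply: contra_notP nf => /eqP fv; exists v.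
have := L2P f; rewrite L2predE => sf.
have E u : f u * (f u)^* * ((lam u)%:num)%:C
    = (normc (f u) ^+ 2 * (lam u)%:num)%:C.
  rewrite rmorphM /=; congr (_ * _); rewrite rmorphXn /=.
  by rewrite -[(normc (f u))%:C]/(`|f u|) normCK.
rewrite /L2dot (eq_fun E) /csum /= rsum0 ltcR.
rewrite (lt_le_trans _ (le_rsum1 v sf _)) //.
  by rewrite mulr_gt0 // exprn_gt0 // lt_def normc_ge0 andbT; apply: contra fv0 => /eqP/eq0_normc->.
by move=> u; rewrite mulr_ge0 // sqr_ge0.
Qed.

HB.instance Definition _ := isDotProduct.Build R[i] L2 L2dot L2dot_gt0.

HB.instance Definition _ := Lmodule_isNormed.Build R[i] L2
  (dot_normD L2dot) (dot_normZ L2dot) (@dot_norm_eq0 _ _ L2dot).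

(* [C_phi] maps the space into itself *)
Definition comp_stable (phi : T -> T) :=
  forall f : L2, (fun v => f (phi v)) \in L2pred.

Definition comp_op (phi : T -> T) (phiL2 : comp_stable phi) (f : L2) : L2 :=
  MkL2 (phiL2 f).

Lemma comp_op_linear phi (phiL2 : comp_stable phi) : linear (comp_op phiL2).
Proof. by move=> c f g; apply/val_inj. Qed.

HB.instance Definition _ phi (phiL2 : comp_stable phi) :=
  GRing.isLinear.Build R[i] L2 L2 *:%R (comp_op phiL2) (comp_op_linear phiL2).

(* The choice of w is irrelevant when [phi] is injective. *)
Definition preim_weight (phi : T -> T) (u : T) : R :=
  if pselect (exists w, phi w = u) is left w then (lam (projT1 (cid w)))%:num
  else 0.

End L2.

Section operators.
Variables (R : realType) (H : normedModType R[i]) (dot : {dot H for Num.conj}).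
Implicit Types A B : {linear H -> H}.

Definition compact_operator A := precompact (A @` [set f | `|f| <= 1]).

Definition adjoint A B := forall f g, dot (A f) g = dot f (B g).

Definition has_dim (E : set H) (k : nat) := exists e : 'I_k -> H,
  [/\ forall i, E (e i),
      forall c : 'I_k -> R[i], \sum_i c i *: e i = 0 -> forall i, c i = 0 &
      forall f, E f -> exists c : 'I_k -> R[i], f = \sum_i c i *: e i].

(* [mu] lists the positive square roots of the eigenvalues of A^* A in
   nonincreasing order, each repeated according to the dimension of its
   eigenspace, and is padded with zeros when there are finitely many. *)
Definition singular_values A (mu : nat -> R) := exists B, adjoint A B /\
  [/\ forall n, 0 <= mu n,
      nonincreasing_seq mu &
      forall s, 0 < s -> exists k : nat,
        has_dim [set f | B (A f) = (s ^+ 2)%:C *: f] k /\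
        [set n | mu n = s] #= `I_k].

Definition schatten_class (p : R) A := compact_operator A /\
  exists mu, singular_values A mu /\
    (\sum_(0 <= n <oo) (`|mu n| `^ p)%:E < +oo)%E.

End operators.

(* Main.v *)
Require Import Defs.
From mathcomp Require Import all_boot all_order all_algebra.
From mathcomp Require Import all_classical all_reals all_analysis.
From mathcomp Require Import complex.

Set Implicit Arguments.
Unset Strict Implicit.
Unset Printing Implicit Defensive.

Import Order.TTheory GRing.Theory Num.Theory numFieldNormedType.Exports.
Import Normc.

Local Open Scope classical_set_scope.
Local Open Scope ring_scope.

(* Since [phi] is injective, [C_phi^* C_phi] is multiplication by the function
   [w u = lam (phi^-1 u) / lam u]. Its eigenspace at [t] contains the point
   masses at the [u] with [w u = t], so at most as many [u] satisfy [w u = t]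
   as there are singular values equal to [sqrt t]. Hence the positive values
   [w u ^ (p/2)] form, with multiplicities, a subfamily of [mu n ^ p]. *)

(** This dichotomy feeds the dimension count: when the cardinality bound fails, for finite or
    infinite [A], linear algebra needs an explicit family of [k.+1] distinct points. *)
Lemma card_leI_or_geI (T : choiceType) (A : set T) (k : nat) :
  (A #<= `I_k)%card \/
  exists u : 'I_k.+1 -> T, injective u /\ forall i, A (u i).
Proof.
have from_seq (s : seq T) : uniq s -> (k < size s)%N ->
    (forall x, x \in s -> A x) ->
    exists u : 'I_k.+1 -> T, injective u /\ forall i, A (u i).
  case: s => // x0 s us ks sA; exists (fun i => nth x0 (x0 :: s) i); split.
    move=> i j /eqP; rewrite nth_uniq ?(leq_trans (ltn_ord _)) //.
    by move=> /eqP/val_inj.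
  by move=> i; apply/sA/mem_nth; rewrite (leq_trans (ltn_ord _)).
have [/finite_setP[n An]|infA] := pselect (finite_set A); last first.
  have [B BA kB] := infinite_set_fset k.+1 infA.
  by right; apply: (from_seq (finmap.enum_fset B)) => //; exact: finmap.fset_uniq.
have [nk|kn] := leqP n k.
  by left; move/card_eqPle: An => [An _]; rewrite (card_le_trans An) ?card_le_II.
right; have finA : finite_set A by apply/finite_setP; exists n.
apply: (from_seq (finmap.enum_fset (fset_set A))).
- exact: finmap.fset_uniq.
- have := card_fset_set An; rewrite /= => E.
  by rewrite -E in kn.
- by move=> x; rewrite in_fset_set // inE.
Qed.

Lemma esum_supp1 (R : realType) (T : choiceType) (u : T) (a : T -> \bar R) :
  (forall v, v != u -> a v = 0%E) -> (0 <= a u)%E ->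
  \esum_(v in [set: T]) a v = a u.
Proof.
move=> a0 au; rewrite -(esum_set1 au) esum_mkcond [RHS]esum_mkcond.
apply: eq_esum => v _; rewrite in_setT.
by case: ifPn => // vu; apply: a0; apply: contra vu; rewrite inE => /eqP.
Qed.

Lemma rsummable_supp1 (R : realType) (T : choiceType) (u : T) (a : T -> R) :
  (forall v, v != u -> a v = 0) -> rsummable a.
Proof.
move=> a0; rewrite /rsummable /summable (@esum_supp1 _ _ u) ?ltry //.
by move=> v vu; rewrite /= a0 // normr0.
Qed.

Lemma rsum_supp1 (R : realType) (T : choiceType) (u : T) (a : T -> R) :
  (forall v, v != u -> a v = 0) -> rsum a = a u.
Proof.
move=> a0; rewrite /rsum.
rewrite (@esum_supp1 _ _ u) ?funepos_ge0 //; last first.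
  by move=> v vu; rewrite funeposE /= a0 // maxxx.
rewrite (@esum_supp1 _ _ u) ?funeneg_ge0 //; last first.
  by move=> v vu; rewrite funenegE /= a0 // oppr0 maxxx.
rewrite funeposE funenegE /= !maxEge. rewrite !lee_fin oppr_ge0.
by case: ltrgtP => [||<-] /=; rewrite ?subr0 ?sub0r ?opprK.
Qed.

Lemma csum_supp1 (R : realType) (T : choiceType) (u : T) (F : T -> R[i]) :
  (forall v, v != u -> F v = 0) -> csum F = F u.
Proof.
move=> F0; rewrite /csum !(@rsum_supp1 _ _ u) => [|v /F0->|v /F0->] //.
by case: (F u).
Qed.

Section point_masses.
Variables (R : realType) (T : choiceType) (lam : T -> {posnum R}).

Lemma indic_L2 (u : T) : (fun v => (v == u)%:R : R[i]) \in L2pred lam.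
Proof.
rewrite L2predE; apply: (@rsummable_supp1 _ _ u) => v /negPf->.
by rewrite [normc _](normc0 R) expr0n mul0r.
Qed.

(** The point mass is not normalised: its squared norm is the weight at [u], so [C_phi] maps point
    masses to point masses or to zero without any scalar factor. *)
Definition L2delta (u : T) : L2 lam := MkL2 (indic_L2 u).

Lemma L2dot_delta (f : L2 lam) (u : T) :
  L2dot f (L2delta u) = f u * ((lam u)%:num)%:C%C.
Proof.
rewrite /L2dot (@csum_supp1 _ _ u) /= ?eqxx ?rmorph1 ?mulr1 //.
by move=> v /negPf->; rewrite rmorph0 mulr0 mul0r.
Qed.

Variables (phi : T -> T) (phiL2 : comp_stable lam phi).
Hypothesis phi_inj : injective phi.

Lemma preim_weight_image (w : T) : preim_weight lam phi (phi w) = (lam w)%:num.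
Proof.
rewrite /preim_weight; case: pselect => [e|[]]; last by exists w.
by case: cid => v /= /phi_inj->.
Qed.

Lemma preim_weight_ge0 (u : T) : 0 <= preim_weight lam phi u.
Proof. by rewrite /preim_weight; case: pselect. Qed.

(** By injectivity, [C_phi] sends the point mass at [phi w] to the point mass at [w], and the point
    mass at a vertex outside the image of [phi] to 0. *)
Lemma L2dot_comp_delta (f : L2 lam) (u : T) :
  L2dot (comp_op phiL2 f) (comp_op phiL2 (L2delta u)) =
  f u * (preim_weight lam phi u)%:C%C.
Proof.
have [[w <-]|nu] := pselect (exists w, phi w = u).
  suff -> : comp_op phiL2 (L2delta (phi w)) = L2delta w.
    by rewrite L2dot_delta preim_weight_image.
  by apply/val_inj/funext => v /=; rewrite (inj_eq phi_inj).
suff -> : comp_op phiL2 (L2delta u) = 0.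
  by rewrite linear0r /preim_weight; case: pselect => // _; rewrite mulr0.
apply/val_inj/funext => v /=; case: eqP => // pv.
by case: nu; exists v.
Qed.

(** Pairing with the point mass at [u] reads off the value at [u] times the nonzero factor [lam u];
    the adjoint relation turns this pairing into the one of [L2dot_comp_delta]. *)
Lemma adjoint_comp_compE (B : {linear L2 lam -> L2 lam}) (f : L2 lam) (u : T) :
  adjoint (@L2dot R T lam) (comp_op phiL2) B ->
  B (comp_op phiL2 f) u = (preim_weight lam phi u / (lam u)%:num)%:C%C * f u.
Proof.
move=> AB; have lu : ((lam u)%:num)%:C%C != 0 :> R[i].
  by rewrite fmorph_eq0.
apply: (mulIf lu); rewrite -L2dot_delta L2dotC -AB -L2dotC L2dot_comp_delta.
by rewrite [RHS]mulrAC -rmorphM /= divfK // mulrC.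
Qed.

(** Point masses at [k.+1] distinct vertices of level [t] would be independent eigenvectors in a
    space spanned by [k] vectors. *)
Lemma card_weight_level (B : {linear L2 lam -> L2 lam}) (t : R) (k : nat) :
  adjoint (@L2dot R T lam) (comp_op phiL2) B ->
  has_dim [set f | B (comp_op phiL2 f) = t%:C%C *: f] k ->
  ([set u | preim_weight lam phi u / (lam u)%:num = t] #<= `I_k)%card.
Proof.
move=> AB [e [_ _ espan]].
have [//|[u [u_inj ut]]] :=
  card_leI_or_geI [set u | preim_weight lam phi u / (lam u)%:num = t] k.
have /choice[c cE] (i : 'I_k.+1) :
    exists c : 'I_k -> R[i], L2delta (u i) = \sum_j c j *: e j.
  apply/espan/val_inj/funext => v; rewrite [LHS]adjoint_comp_compE //.
  rewrite -[RHS]/(t%:C%C * (v == u i)%:R) /=.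
  by have [->|_] := eqVneq v (u i); rewrite ?ut ?mulr0.
have L2_sumE (I : finType) (F : I -> L2 lam) (v : T) :
    (\sum_i F i) v = \sum_i F i v.
  by elim/big_rec2: _ => // i x y _ <-.
pose M := \matrix_(i < k.+1, j < k) c i j.
pose N := \matrix_(j < k, i < k.+1) e j (u i).
(* Evaluating the expansion of the [i]-th point mass at the vertices [u i'] factors the identity of
   size [k.+1] through dimension [k], which the rank forbids. *)
suff /mulmx1_min : M *m N = 1%:M by rewrite ltnn.
apply/matrixP => i i'; rewrite !mxE.
have /(congr1 (fun f : L2 lam => f (u i'))) := cE i.
rewrite L2_sumE /= (inj_eq u_inj) eq_sym => ->.
by apply: eq_bigr => j _; rewrite !mxE.
Qed.

End point_masses.

(* Level sets transfer injectively one level at a time; the injections glue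
   because [nu] recovers the level. *)
Lemma level_sets_injection (R : realType) (T : Type) (w : T -> R)
    (nu : nat -> R) (D : set R) :
  (forall t, D t -> ([set u | w u = t] #<= [set n | nu n = t])%card) ->
  exists j : T -> nat, set_inj (w @^-1` D) j /\
    forall u, D (w u) -> nu (j u) = w u.
Proof.
move=> le; have /choice[g gP] (t : R) : exists g : T -> nat, D t ->
    set_inj [set u | w u = t] g /\ forall u, w u = t -> nu (g u) = t.
  have [Dt|nDt] := pselect (D t); last by exists (fun=> 0%N).
  have /pcard_leP/injfunPex[g gS g_inj] := le _ Dt.
  by exists g => _; split => // u; exact: gS.
exists (fun u => g (w u) u); split => [u v|u Du]; last first.
  by have [_] := gP _ Du; exact.
rewrite !inE => Du Dv E.
have [inju eu] := gP _ Du; have [_ ev] := gP _ Dv.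
have wuv : w u = w v by rewrite -(eu u) // -(ev v) // E.
by rewrite -wuv in E; apply: inju => //; rewrite inE.
Qed.

Theorem theorem4p6 (R : realType) (T : tree) (lam : T -> {posnum R})
    (phi : T -> T) (p : R) (p_gt2 : 2 < p) (phi_inj : injective phi)
    (phiL2 : comp_stable lam phi)
    (Cphi_compact : compact_operator (comp_op phiL2))
    (Cphi_Sp : schatten_class (@L2dot R T lam) p (comp_op phiL2)) :
  (\esum_(u in [set: T])
     ((preim_weight lam phi u / (lam u)%:num) `^ (p / 2))%:E < +oo)%E.
Proof.
case: Cphi_Sp => _ [mu [[B [AB [mu0 _ mudim]]] summu]].
pose w u := preim_weight lam phi u / (lam u)%:num.
have w0 u : 0 <= w u by rewrite divr_ge0 // preim_weight_ge0.
(* Eigenvalues of [C_phi^* C_phi] are squares of singular values, hence [mu n ^+ 2]. Only positive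
   levels are matched, since multiplicities are prescribed for positive singular values alone. *)
have [|j [j_inj jE]] := @level_sets_injection R T w (fun n => mu n ^+ 2)
    [set t | 0 < t].
  move=> t /= t0; have st0 : 0 < Num.sqrt t by rewrite sqrtr_gt0.
  have [k [dimk cardk]] := mudim _ st0.
  rewrite sqr_sqrtr ?ltW // in dimk.
  have /card_le_trans := card_weight_level phi_inj AB dimk.
  apply; move/card_eqPle: cardk => [_ le]; apply: (card_le_trans le).
  by apply: subset_card_le => n /= ->; rewrite sqr_sqrtr ?ltW.
(* A zero base raised to the power 0 gives 1, so a nonzero exponent is what makes the vertices with
   [w u = 0] drop out of the sum. *)
have p0 : p / 2 != 0.
  by rewrite gt_eqF // divr_gt0 // (lt_trans _ p_gt2).
have -> : \esum_(u in [set: T]) ((w u) `^ (p / 2))%:E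
    = \esum_(u in w @^-1` [set t | 0 < t]) (`|mu (j u)| `^ p)%:E.
  rewrite [RHS]esum_mkcond; apply: eq_esum => u _; case: ifPn.
    rewrite in_setE /= => wu; rewrite -jE // ger0_norm // -powR_mulrn // -powRrM.
    by rewrite mulrC divfK.
  rewrite notin_setE /= => /negP.
  by rewrite lt_def w0 andbT negbK => /eqP->; rewrite powR0.
(* Injectivity of [j] makes this a sum over a set of indices [n], bounded by the full series because
   its terms are nonnegative. *)
rewrite -(esum_image _ _ (fun n => (`|mu n| `^ p)%:E) j_inj).
apply: le_lt_trans summu; rewrite nneseries_esumT; last first.
  by move=> n; rewrite lee_fin powR_ge0.
rewrite esum_mkcond; apply: le_esum => n _.
by case: (_ \in _); rewrite ?lee_fin ?powR_ge0.
Qed.
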